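(* Let $m\ge2$, $n\ge1$, let $I$ be a closed interval, let $\gamma\colon I\to\mathbb{R}^{m+n}$ be a smooth embedding, and let $(X_1,\dots,X_{m-1})$ be a smooth $(m-1)$-tuple of vector fields along $\gamma$ such that $\dot\gamma(t)\wedge X_1(t)\wedge\dots\wedge X_{m-1}(t)\ne0$ for all $t\in I$. Let $\sigma\colon I\times\mathbb{R}^{m-1}\to\mathbb{R}^{m+n}$, $\sigma(t,u)=\gamma(t)+\sum_{j=1}^{m-1}u^jX_j(t)$, and let $V\subset\mathbb{R}^{m-1}$ be an open box containing the origin such that $\sigma|_{I\times V}$ is a smooth embedding. Then $\sigma|_{I\times V}$ is rank-one if and only if it is ruled (i.e., without planar points) and the following $m-1$ equations are fulfilled on $I$: $$\overline{D}_tX_j\wedge\dot\gamma\wedge X_1\wedge\dots\wedge X_{m-1}=0,\qquad j=1,\dots,m-1.$$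
   Context: $\overline{D}_t$ is the Euclidean covariant derivative along $\gamma$ (componentwise $t$-derivative), and $\wedge$ is the wedge product in the exterior algebra of $\mathbb{R}^{m+n}$. Let $M$ be an $m$-dimensional embedded submanifold of $\mathbb{R}^{m+n}$ with second fundamental form $\alpha$. A planar point is a point where $\alpha$ vanishes. $M$ is ruled if it has no planar points and is foliated by open subsets of $(m-1)$-dimensional affine subspaces of $\mathbb{R}^{m+n}$, called rulings. $M$ is rank-one if at every $p\in M$ the nullity space $\{x\in T_pM\mid\alpha(x,\cdot)=0\}$ has dimension $m-1$. The submanifold $\sigma|_{I\times V}$ is the image $\sigma(I\times V)$; it is foliated by the sets $\sigma(\{t\}\times V)$, so it is ruled exactly when it has no planar points. *)

(* Defs.v *)
From HB Require Import structures.
From mathcomp Require Import all_boot all_order all_algebra.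
From mathcomp Require Import all_classical all_reals all_analysis.
Set Implicit Arguments.
Unset Strict Implicit.
Unset Printing Implicit Defensive.
Import Order.TTheory GRing.Theory Num.Theory.
Import numFieldNormedType.Exports.
Local Open Scope classical_set_scope.
Local Open Scope ring_scope.

(** Smoothness and embeddings *)

(* All iterated directional derivatives of order at most [k] exist and are
   continuous on [U]; only used for [U] open and in finite dimension, where this
   is the usual class C^k. *)
Fixpoint Ck_on (R : realType) (P Q : normedModType R) (U : set P) (k : nat)
    (f : P -> Q) : Prop :=
  (forall p, U p -> {for p, continuous f}) /\
  (if k is k'.+1 then
     forall v : P, (forall p, U p -> derivable f p v) /\ Ck_on U k' ('D_v f)
   else True).

(* Smoothness on an arbitrary subset, e.g. on a closed interval or on the product
   of a closed interval with an open set: local existence of smooth extensions. *)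
Definition smooth_on (R : realType) (P Q : normedModType R) (A : set P)
    (f : P -> Q) : Prop :=
  forall p, A p -> exists (U : set P) (g : P -> Q),
    [/\ open U, U p, forall k, Ck_on U k g & forall q, A q -> U q -> f q = g q].

(* Derivative of [f] at [p] in the direction [v], taken inside [A]: the limit runs
   over the h with p + h v in A.  It is one-sided where needed at the boundary, and
   only depends on the values of [f] on [A] (for [p] in [A]). *)
Definition deriv_in (R : realType) (P Q : normedModType R) (A : set P)
    (f : P -> Q) (p v : P) : Q :=
  lim ((fun h : R => h^-1 *: (f (p + h *: v) - f p))
         @ within [set h : R | A (p + h *: v)] 0^').

Definition smooth_embedding (R : realType) (P Q : normedModType R) (A : set P)
    (f : P -> Q) : Prop :=
  [/\ smooth_on A f,
      (* immersion *)
      forall p, A p -> injective (deriv_in A f p),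
      {in A &, injective f} &
      (* [A] carries the topology induced from the image *)
      forall U : set P, open U ->
        exists2 O : set Q, open O & f @` (A `&` U) = f @` A `&` O].

(** The exterior algebra of R^N: a multivector is given by its coordinates in the
    basis e_S = e_i1 /\ ... /\ e_ik, for S = {i1 < ... < ik}. *)

Section Exterior.
Variables (R : realType) (N : nat).

Definition ext := {ffun {set 'I_N} -> R}.

(* e_A /\ e_B = (-1)^(inversions A B) e_(A u B) for disjoint [A] and [B] *)
Definition inversions (A B : {set 'I_N}) : nat :=
  #|[set p : 'I_N * 'I_N | [&& p.1 \in A, p.2 \in B & (p.2 < p.1)%N]]|.

Definition wedge (x y : ext) : ext :=
  [ffun S : {set 'I_N} => \sum_(A : {set 'I_N} | A \subset S)
     (-1) ^+ inversions A (S :\: A) * x A * y (S :\: A)].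

Definition ext1 : ext := [ffun S : {set 'I_N} => (S == finset.set0)%:R].

Definition ext_vec (v : 'rV[R]_N) : ext :=
  [ffun S : {set 'I_N} => \sum_(i < N | S == [set i]%SET) v 0 i].

Definition wedge_seq (s : seq 'rV[R]_N) : ext :=
  \big[wedge/ext1]_(v <- s) ext_vec v.

End Exterior.

(** Parametrized submanifolds: [f], restricted to [A], is a smooth embedding with
    image the submanifold M.  Points of M are designated by their parameter q in A,
    and vector fields along M are functions of the parameter. *)

Section Submanifold.
Variables (R : realType) (N : nat).
Local Notation E := 'rV[R]_N.

Definition dotp (x y : E) : R := \sum_(i < N) x 0 i * y 0 i.

Section SecondFundamentalForm.
Variables (P : normedModType R) (A : set P) (f : P -> E).

Definition tangent_space (q : P) : set E := range (deriv_in A f q).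

Definition normal_part (q : P) (z w : E) : Prop :=
  (forall y, tangent_space q y -> dotp w y = 0) /\ tangent_space q (z - w).

Definition tangent_field (Y : P -> E) : Prop :=
  smooth_on A Y /\ forall q, A q -> tangent_space q (Y q).

(* alpha_q(x, y) is the normal part of the Euclidean derivative in the direction
   x = df_q(v) of a tangent vector field [Y] with value [y] at [q].  It does not
   depend on [Y], so that [xget] selects the unique such value. *)
Definition second_fundamental_form (q : P) (x y : E) : E :=
  xget 0 [set w | exists (v : P) (Y : P -> E),
    [/\ deriv_in A f q v = x, tangent_field Y, Y q = y
      & normal_part q (deriv_in A Y q v) w]].

Definition planar_point (q : P) : Prop :=
  forall x y, tangent_space q x -> tangent_space q y ->
    second_fundamental_form q x y = 0.

Definition nullity_space (q : P) : set E :=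
  [set x | tangent_space q x /\
    forall y, tangent_space q y -> second_fundamental_form q x y = 0].

(* [d] is the dimension of the submanifold *)
Definition rank_one (d : nat) : Prop :=
  forall q, A q -> exists2 W : {vspace E},
    \dim W = d.-1 & nullity_space q = [set x | x \in W].

End SecondFundamentalForm.

Definition open_in_affine_subspace (d : nat) (L : set E) : Prop :=
  exists (c : E) (W : {vspace E}) (O : set E),
    [/\ \dim W = d, open O & L = O `&` [set x | x - c \in W]].

(* [F] is a foliation of the d-dimensional submanifold [M], possibly with boundary,
   by leaves of dimension d - 1 transverse to the boundary or contained in it: near
   each point of [M] there is a smooth parametrization [phi] of a relatively open
   subset of [M] by J x B, with J an interval and B open in R^(d-1), whose plaques
   phi({t} x B) are each contained in a single leaf. *)
Definition foliation (d : nat) (M : set E) (F : set (set E)) : Prop :=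
  [/\ \bigcup_(L in F) L = M,
      forall L L', F L -> F L' -> L `&` L' !=set0 -> L = L',
      forall L, F L -> L !=set0 /\ connected L &
      forall p, M p ->
        exists (J : set R) (B : set 'rV[R]_d.-1) (O : set E)
               (phi : R^o * 'rV[R]_d.-1 -> E),
        [/\ is_interval J /\ (interior J) !=set0, open B,
            smooth_embedding (J `*` B) phi,
            [/\ open O, O p & phi @` (J `*` B) = M `&` O] &
            forall t, J t -> exists2 L, F L & phi @` ([set t] `*` B) `<=` L]].

Definition ruled (P : normedModType R) (A : set P) (f : P -> E) (d : nat) : Prop :=
  (forall q, A q -> ~ planar_point A f q) /\
  exists F : set (set E), foliation d (f @` A) F /\
    forall L, F L -> open_in_affine_subspace d.-1 L.

End Submanifold.

(* The closed intervals with nonempty interior, bounded or not, are the sets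
   [closed_interval a b] with a < b. *)
Definition closed_interval (R : realType) (a b : \bar R) : set R^o :=
  [set t : R | (a <= t%:E)%E /\ (t%:E <= b)%E].

Definition open_box (R : realType) (k : nat) (c d : 'I_k -> \bar R) :
    set 'rV[R]_k :=
  [set u | forall j, (c j < (u 0%R j)%:E)%E /\ ((u 0%R j)%:E < d j)%E].

Definition ruled_param (R : realType) (N k : nat) (gamma : R^o -> 'rV[R]_N)
    (X : 'I_k -> R^o -> 'rV[R]_N) (q : R^o * 'rV[R]_k) : 'rV[R]_N :=
  gamma q.1 + \sum_(j < k) q.2 0 j *: X j q.1.

(* Main.v *)
Require Import Defs.
From mathcomp Require Import all_boot all_order all_algebra.
From mathcomp Require Import all_classical all_reals all_analysis.
From mathcomp Require Import ring lra.
Import Order.TTheory GRing.Theory Num.Theory.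
Import numFieldNormedType.Exports.
Local Open Scope classical_set_scope.
Local Open Scope ring_scope.

(** Write [q = (t, u)] and let [T q] be the tangent space at [q], spanned by
    [e0 = gamma' t + sum_j u_j X_j' t] and the [X_j t].  In the coordinates
    [(t, u)] the second fundamental form is the second derivative of [sigma]
    modulo [T q]: its entries are some vector [C q] for [(t, t)], [X_j' t] for
    [(t, u_j)], and [0] for [(u_i, u_j)].  If some [X_j' t] is not in [T q], the
    nullity space is a proper subspace of the span of the [X_j t]; if all of them
    are, it is that span or, when [q] is planar, the whole of [T q].
    Hence rank one at [q] means that [q] is not planar and all [X_j' t] lie in
    [T q].  If [X_j' t] is in [T (t, 0)] for all j, then [T (t, u)] is contained in
    [T (t, 0)], hence equal to it, so it suffices to have the condition at [u = 0],
    where it is the vanishing of the wedge products. *)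

(** * Wedge products of vectors, linear independence and span *)

Section ExteriorAlgebra.
Set Implicit Arguments.
Unset Strict Implicit.
Variables (R : realType) (N : nat).
Local Notation E := 'rV[R]_N.
Implicit Types (v w z phi : E) (x y : ext R N) (S : {set 'I_N}) (i j : 'I_N).

(** The sign that moves $e_i$ to its place: $e_i \wedge e_{S \setminus i}$ is [esign i S] times
    $e_S$ when $i \in S$. Contraction uses the same sign for $i \notin S$. *)
Definition esign i S : R := (-1) ^+ #|[set j in S | (j < i)%N]%SET|.

(** In the sum defining [wedge], only the singletons {i} with $i \in S$ contribute, and the
    inversions of ({i}, S \ i) correspond to the elements of $S$ below $i$. *)
Lemma wedge_vecE v x S :
  wedge (ext_vec v) x S = \sum_(i in S) esign i S * v 0 i * x (S :\ i).
Proof.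
rewrite ffunE.
under eq_bigr => A _ do rewrite ffunE mulr_sumr mulr_suml.
rewrite (exchange_big_dep predT) //= [RHS]big_mkcond /=; apply: eq_bigr => i _.
rewrite (eq_bigl (fun A => (A == [set i]%SET) && (i \in S))); last first.
  by move=> A; rewrite andbC; case: eqP => //= ->; rewrite finset.sub1set.
case: ifP => iS; last by rewrite big_pred0 // => A; rewrite andbF.
rewrite (eq_bigl (pred1 [set i]%SET)); last by move=> A; rewrite andbT.
rewrite big_pred1_eq /esign /inversions.
congr (_ ^+ _ * _ * _).
rewrite -(card_imset (mem [set j in S | (j < i)%N]%SET) (f := fun j => (i, j))); last first.
  by move=> j k [].
apply: eq_card => -[k j].
apply/idP/imsetP; rewrite in_setE /=.
  rewrite !inE => /and3P[/eqP -> /andP[_ jS] ji].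
  by exists j => //; rewrite inE jS.
move=> [l]; rewrite !inE => /andP[lS li] [-> ->]; rewrite eqxx lS li /= !andbT.
by apply: contraTneq li => ->; rewrite ltnn.
Qed.

Lemma wedge_seq_cons v s :
  wedge_seq (v :: s) = wedge (ext_vec v) (wedge_seq s).
Proof. by rewrite /wedge_seq big_cons. Qed.

Lemma esignD1 i j S : j \in S ->
  esign i (S :\ j) = (if (j < i)%N then -1 else 1) * esign i S.
Proof.
move=> jS; rewrite /esign.
case: ifPn => ji.
  rewrite [in RHS](cardsD1 j) !inE jS ji /= exprS mulrA mulrNN !mul1r.
  congr (_ ^+ _); apply: eq_card => k; rewrite !inE.
  by rewrite andbA.
rewrite mul1r; congr (_ ^+ _); apply: eq_card => k; rewrite !inE.
by case: eqP => //= ->; rewrite (negbTE ji) andbF.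
Qed.

(** Each coordinate is a double sum over ordered pairs of distinct indices $i, j \in S$. Exchanging
    $i$ and $j$ changes the sign of the summand, so the sum equals its own negative. *)
Lemma wedge_vecK v x : wedge (ext_vec v) (wedge (ext_vec v) x) = [ffun=> 0].
Proof.
apply/ffunP => S; rewrite wedge_vecE ffunE.
under eq_bigr => i iS do rewrite wedge_vecE mulr_sumr.
set s := (X in X = _); suff : s = - s.
  by move=> /eqP; rewrite -addr_eq0 -mulr2n mulrn_eq0 /= => /eqP.
rewrite {1}/s (exchange_big_dep (mem S)) /=; last first.
  by move=> i j _; rewrite !inE => /andP[].
rewrite /s -sumrN; apply: eq_bigr => j jS.
rewrite -sumrN; apply: eq_big => [i|i].
  by rewrite !inE jS andbT eq_sym andbC.
rewrite !inE jS andbT => /andP[iS ji].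
rewrite !esignD1 //.
have -> : S :\ i :\ j = (S :\ j :\ i)%SET.
  by apply/setP => k; rewrite !inE andbCA.
have := ji; rewrite neq_ltn => /orP[ltij|ltji].
  by rewrite ltij ltnNge (ltnW ltij) /=; ring.
by rewrite ltji ltnNge (ltnW ltji) /=; ring.
Qed.

Lemma wedge_vecDl v w x S :
  wedge (ext_vec (v + w)) x S = wedge (ext_vec v) x S + wedge (ext_vec w) x S.
Proof.
rewrite !wedge_vecE -big_split /=; apply: eq_bigr => i _.
by rewrite mxE; ring.
Qed.

Lemma wedge_vecZl (k : R) v x S :
  wedge (ext_vec (k *: v)) x S = k * wedge (ext_vec v) x S.
Proof.
rewrite !wedge_vecE mulr_sumr; apply: eq_bigr => i _.
by rewrite mxE; ring.
Qed.

Lemma wedge_vecDr v x y S :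
  wedge (ext_vec v) [ffun T => x T + y T] S =
  wedge (ext_vec v) x S + wedge (ext_vec v) y S.
Proof.
rewrite !wedge_vecE -big_split /=; apply: eq_bigr => i _.
by rewrite ffunE; ring.
Qed.

Lemma wedge_vec0r v : wedge (ext_vec v) [ffun=> 0] = [ffun=> 0].
Proof.
apply/ffunP => S; rewrite wedge_vecE ffunE big1 // => i _.
by rewrite ffunE mulr0.
Qed.

(** Polarization of [wedge_vecK] at [v + w]. *)
Lemma wedge_vecC v w x S :
  wedge (ext_vec v) (wedge (ext_vec w) x) S =
  - wedge (ext_vec w) (wedge (ext_vec v) x) S.
Proof.
have H u T : wedge (ext_vec u) (wedge (ext_vec u) x) T = 0.
  by rewrite wedge_vecK ffunE.
have := H (v + w) S.
have -> : wedge (ext_vec (v + w)) x =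
    [ffun T => wedge (ext_vec v) x T + wedge (ext_vec w) x T].
  by apply/ffunP => T; rewrite [RHS]ffunE wedge_vecDl.
rewrite wedge_vecDl !wedge_vecDr !H add0r addr0 => /eqP.
by rewrite addr_eq0 => /eqP.
Qed.

(** By anticommutation the leading [v] moves to the right until it meets its other copy, where
    [wedge_vecK] applies. *)
Lemma wedge_seq_mem v s : v \in s -> wedge_seq (v :: s) = [ffun=> 0].
Proof.
elim: s => // w s IHs; rewrite inE !wedge_seq_cons => /predU1P[->|vs].
  exact: wedge_vecK.
apply/ffunP => S; rewrite wedge_vecC -wedge_seq_cons IHs //.
by rewrite wedge_vec0r !ffunE oppr0.
Qed.

Lemma span_ind (P : E -> Prop) (s : seq E) z :
  P 0 -> (forall k v w, v \in s -> P w -> P (k *: v + w)) ->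
  z \in << s >>%VS -> P z.
Proof.
move=> P0 PD; rewrite -[s]/(tval (in_tuple s)) => /coord_span ->.
elim/big_rec: _ => // i y _; apply: PD.
by rewrite mem_nth // ltn_ord.
Qed.

Lemma wedge_seq_span0 z (s : seq E) :
  z \in << s >>%VS -> wedge_seq (z :: s) = [ffun=> 0].
Proof.
move=> zs; apply/ffunP => S; rewrite wedge_seq_cons [RHS]ffunE.
move: zs; apply: (@span_ind (fun z => wedge (ext_vec z) (wedge_seq s) S = 0)) => [|k v w vs Hw].
  by rewrite wedge_vecE big1 // => i _; rewrite mxE mulr0 mul0r.
rewrite wedge_vecDl wedge_vecZl -wedge_seq_cons wedge_seq_mem // Hw ffunE.
by rewrite mulr0 addr0.
Qed.

(* Contraction by the linear form [dotp phi]. *)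
Definition contract phi x : ext R N :=
  [ffun S : {set 'I_N} => \sum_(i | i \notin S) esign i S * phi 0 i * x (i |: S)%SET].

Lemma esignD1_id i S : esign i (S :\ i) = esign i S.
Proof.
congr (_ ^+ _); apply: eq_card => k; rewrite !inE.
by case: eqP => //= ->; rewrite ltnn andbF.
Qed.

Lemma esignMM i S : esign i S * esign i S = 1.
Proof. by rewrite -expr2 sqrr_sign. Qed.

(** Contraction is an antiderivation. With $i$ the contracted index and $j$ the wedged one, the
    terms with $i = j$ from both sides add up to the inner product, and those with $i \ne j$
    cancel. *)
Lemma contract_wedge phi v x S :
  contract phi (wedge (ext_vec v) x) S =
  dotp phi v * x S - wedge (ext_vec v) (contract phi x) S.
Proof.
(* [cross] collects the terms with $i \ne j$, which forces $i \notin S$ and $j \in S$; it enters the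
   two expansions with opposite signs. *)
pose cross := \sum_(i | i \notin S) \sum_(j in S)
  esign i S * phi 0 i * (esign j (i |: S)%SET * v 0 j * x ((i |: S) :\ j)%SET).
have -> : contract phi (wedge (ext_vec v) x) S =
    \sum_(i | i \notin S) phi 0 i * v 0 i * x S + cross.
  rewrite ffunE -big_split /=; apply: eq_bigr => i iS.
  rewrite wedge_vecE (bigD1 i) ?setU11 //= mulrDr; congr (_ + _).
    by rewrite -(esignD1_id i (i |: S)%SET) setU1K // -[RHS]mul1r -(esignMM i S); ring.
  rewrite mulr_sumr; apply: eq_bigl => j; rewrite !inE.
  by case: (eqVneq j i) => [->|_] /=; rewrite ?andbT ?(negbTE iS).
suff -> : wedge (ext_vec v) (contract phi x) S =
    \sum_(i in S) phi 0 i * v 0 i * x S - cross.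
  rewrite /dotp mulr_suml [X in _ = X - _](bigID (mem S)) /=.
  by ring.
rewrite wedge_vecE /cross exchange_big /= -sumrB; apply: eq_bigr => j jS.
rewrite ffunE (bigD1 j) ?inE ?eqxx //= mulrDr; congr (_ + _).
  by rewrite esignD1_id finset.setD1K // -[RHS]mul1r -(esignMM j S); ring.
rewrite mulr_sumr -sumrN; apply: eq_big => i.
  by rewrite !inE; case: (eqVneq i j) => [->|_] /=; rewrite ?andbT ?jS.
rewrite !inE negb_and negbK => /andP[/orP[/eqP->|iS ij]]; first by rewrite eqxx.
have -> : ((i |: S) :\ j = i |: (S :\ j))%SET.
  apply/setP => k; rewrite !inE; case: (eqVneq k i) => [->|_] //=.
  by rewrite ij.
have := @esignD1 j i (i |: S)%SET (setU11 i S); rewrite setU1K // => ->.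
rewrite !esignD1 //.
have := ij; rewrite neq_ltn => /orP[lt|lt].
  by rewrite lt ltnNge (ltnW lt) /=; ring.
by rewrite lt ltnNge (ltnW lt) /=; ring.
Qed.

Lemma contract_wedge_seq0 phi (s : seq E) :
  {in s, forall v, dotp phi v = 0} -> contract phi (wedge_seq s) = [ffun=> 0].
Proof.
elim: s => [|v s IHs] H; apply/ffunP => S.
  rewrite ffunE big1 ?ffunE // => i _.
  rewrite /wedge_seq big_nil ffunE; case: eqP => [/setP/(_ i)|]; last by rewrite mulr0.
  by rewrite !inE eqxx.
rewrite wedge_seq_cons contract_wedge IHs; last first.
  by move=> w ws; apply: H; rewrite inE ws orbT.
by rewrite H ?mem_head // wedge_vec0r !ffunE mul0r subrr.
Qed.

Lemma dotpDr v w z : dotp v (w + z) = dotp v w + dotp v z.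
Proof. by rewrite /dotp -big_split; apply: eq_bigr => i _; rewrite mxE mulrDr. Qed.

Lemma dotpZr k v w : dotp v (k *: w) = k * dotp v w.
Proof. by rewrite /dotp mulr_sumr; apply: eq_bigr => i _; rewrite mxE mulrCA. Qed.

Lemma dotpC v w : dotp v w = dotp w v.
Proof. by apply: eq_bigr => i _; rewrite mulrC. Qed.

Lemma dotp_eq0 v : (dotp v v == 0) = (v == 0).
Proof.
apply/eqP/eqP => [|->]; last by rewrite /dotp big1 // => i _; rewrite mxE mul0r.
move/eqP; rewrite psumr_eq0 => [/allP H|i _]; last by rewrite -expr2 sqr_ge0.
apply/rowP => i; rewrite mxE; have := H i (mem_index_enum _).
by rewrite mulf_eq0 orbb => /eqP.
Qed.

(* Gram-Schmidt *)
Lemma orth_decomposition (W : {vspace E}) z :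
  exists w, {in W, forall u, dotp w u = 0} /\ z - w \in W.
Proof.
rewrite -(span_basis (vbasisP W)).
move: (val (vbasis W)) => s {W}.
have H w (t : seq E) : {in t, forall u, dotp w u = 0} ->
    {in <<t>>%VS, forall u, dotp w u = 0}.
  move=> Ht u; apply: (@span_ind (fun u => dotp w u = 0)) => [|k a v vt Hv].
    by rewrite -(scale0r 0) dotpZr mul0r.
  by rewrite dotpDr dotpZr Ht // mulr0 add0r.
elim: s z => [|v s IHs] z.
  by exists z; split; rewrite ?subrr ?mem0v //; apply: H.
have [wv [wvs vs]] := IHs v; have [wz [wzs zs]] := IHs z.
have sub : (<< s >> <= <<v :: s>>)%VS by rewrite span_cons addvSr.
(* [wv] and [wz] are the components of [v] and [z] orthogonal to [s]. If [wv] is zero, then [k] is 0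
   by the convention on division by zero, and nothing has to be subtracted. *)
pose k := dotp wz wv / dotp wv wv.
have vE : dotp wv v = dotp wv wv.
  by rewrite -[in LHS](subrK wv v) dotpDr wvs // add0r.
exists (wz - k *: wv); split; last first.
  rewrite opprB addrCA addrC rpredD ?(subvP sub _ zs) // rpredZ //.
  by rewrite -[wv](subKr v) rpredB ?(subvP sub _ vs) // memv_span ?mem_head.
apply: H => u; rewrite inE dotpC -scaleNr dotpDr dotpZr => /predU1P[->|us].
  rewrite -(dotpC wv) vE dotpC -[v in dotp _ v](subrK wv) dotpDr wzs // add0r.
  rewrite /k; have [/eqP|/divfK] := eqVneq (dotp wv wv) 0.
    rewrite dotp_eq0 => /eqP ->; rewrite -(scale0r 0) dotpZr; ring.
  by rewrite mulNr => ->; rewrite subrr.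
have us' := memv_span us.
by rewrite dotpC wzs // dotpC wvs // mulr0 addr0.
Qed.

(** Contract [wedge_seq (z :: s)] by the component [phi] of [z] orthogonal to the span of [s]. The
    result is $|\phi|^2$ times [wedge_seq s], so [phi] must be zero. *)
Lemma wedge_seq_eq0_span z (s : seq E) :
  wedge_seq s <> [ffun=> 0] -> wedge_seq (z :: s) = [ffun=> 0] -> z \in << s >>%VS.
Proof.
move=> s0 zs0; have [phi [phis zphi]] := orth_decomposition << s >>%VS z.
have [phi0|phi_neq0] := eqVneq phi 0; first by rewrite -[z]subr0 -phi0.
exfalso; apply: s0; apply/ffunP => S.
have := contract_wedge phi z (wedge_seq s) S.
rewrite -wedge_seq_cons zs0 contract_wedge_seq0; last first.
  by move=> v vs; apply: phis; exact: memv_span.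
rewrite wedge_vec0r !ffunE subr0 big1; last by move=> i _; rewrite ffunE mulr0.
move=> /esym/eqP; rewrite mulf_eq0 => /orP[|/eqP//].
rewrite -[z](subrK phi) dotpDr phis // add0r dotp_eq0.
by rewrite (negbTE phi_neq0).
Qed.

Lemma wedge_seq_neq0 (s : seq E) : wedge_seq s <> [ffun=> 0] <-> free s.
Proof.
elim: s => [|v s IHs].
  split=> [_|_ /ffunP/(_ finset.set0)]; first exact: nil_free.
  by rewrite /wedge_seq big_nil !ffunE eqxx => /eqP; rewrite oner_eq0.
rewrite free_cons; split=> [vs|/andP[vs /IHs s0] /(wedge_seq_eq0_span s0)].
  apply/andP; split; first by apply/negP => /wedge_seq_span0.
  by apply/IHs => s0; apply: vs; rewrite wedge_seq_cons s0 wedge_vec0r.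
by rewrite (negbTE vs).
Qed.

Lemma wedge_seq_free (s : seq E) : wedge_seq s <> 0 <-> free s.
Proof. exact: wedge_seq_neq0. Qed.

Lemma wedge_seq_span z (s : seq E) : free s ->
  wedge_seq (z :: s) = 0 <-> z \in << s >>%VS.
Proof.
move=> /wedge_seq_neq0 s0; split; last exact: wedge_seq_span0.
exact: wedge_seq_eq0_span.
Qed.

End ExteriorAlgebra.

(** * Directional derivatives taken inside a set *)

Section DirectionalDerivatives.
Set Implicit Arguments.
Unset Strict Implicit.
Variable R : realType.

Definition along (P : normedModType R) (A : set P) (p v : P) : set_system R :=
  within [set h : R | A (p + h *: v)] 0^'.

#[local] Instance along_filter (P : normedModType R) (A : set P) p v :
  Filter (along A p v).
Proof. exact: within_filter. Qed.

(** Properness of these filters makes limits unique, so that a convergence determines the value of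
    [deriv_in], which is defined through [lim]. *)
Definition accumulating (P : normedModType R) (A : set P) : Prop :=
  forall p v, A p -> ProperFilter (along A p v).

(** A relation instead of a value: the rules of calculus then hold for every set [A], and
    [accumulating] enters only when passing to [deriv_in]. *)
Definition has_deriv_in (P Q : normedModType R) (A : set P) (f : P -> Q)
    (p v : P) (l : Q) : Prop :=
  (fun h : R => h^-1 *: (f (p + h *: v) - f p)) @ along A p v --> l.

Section Rules.
Variables (P Q : normedModType R) (A : set P).
Implicit Types (f g : P -> Q) (p v : P) (l : Q).

Lemma near_along p v : \forall h \near along A p v, A (p + h *: v).
Proof. exact: withinT. Qed.

Lemma near_along_neq0 p v : \forall h \near along A p v, h != 0.
Proof. exact: (cvg_within _ (nbhs_dnbhs_neq (0 : R))). Qed.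

Lemma cvg_along0 p v : (fun h : R => h) @ along A p v --> (0 : R).
Proof. by apply: cvg_within_filter; exact: cvg_within. Qed.

Lemma cvg_along p v : (fun h : R => p + h *: v) @ along A p v --> p.
Proof.
rewrite -[X in _ --> X]addr0 -(scale0r v).
by apply: cvgD; [exact: cvg_cst|apply: cvgZr_tmp; exact: cvg_along0].
Qed.

Lemma has_deriv_inE f p v l : accumulating A -> A p ->
  has_deriv_in A f p v l -> deriv_in A f p v = l.
Proof.
by move=> accA Ap; have ? := accA p v Ap; exact: cvg_lim.
Qed.

Lemma has_deriv_in_eq f g p v l : A p -> {in A, f =1 g} ->
  has_deriv_in A f p v l -> has_deriv_in A g p v l.
Proof.
move=> Ap fg; apply: cvg_trans; apply: near_eq_cvg.
near=> h; rewrite !fg ?inE //; near: h; exact: near_along.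
Unshelve. all: by end_near. Qed.

Lemma has_deriv_inD f g p v l l' :
  has_deriv_in A f p v l -> has_deriv_in A g p v l' ->
  has_deriv_in A (f \+ g) p v (l + l').
Proof.
move=> fl gl; rewrite /has_deriv_in.
have -> : (fun h : R => h^-1 *: ((f \+ g) (p + h *: v) - (f \+ g) p)) =
    (fun h : R => h^-1 *: (f (p + h *: v) - f p)
                  + h^-1 *: (g (p + h *: v) - g p)).
  by apply/funext => h /=; rewrite -scalerDr opprD addrACA.
exact: cvgD.
Qed.

Lemma has_deriv_in_cst (c : Q) p v : has_deriv_in A (cst c) p v 0.
Proof.
rewrite /has_deriv_in.
have -> : (fun h : R => h^-1 *: (cst c (p + h *: v) - cst c p)) = cst 0.
  by apply/funext => h; rewrite subrr scaler0.
exact: cvg_cst.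
Qed.

Lemma has_deriv_in_sum (I : Type) (r : seq I) (f : I -> P -> Q) p v (l : I -> Q) :
  (forall i, has_deriv_in A (f i) p v (l i)) ->
  has_deriv_in A (fun q => \sum_(i <- r) f i q) p v (\sum_(i <- r) l i).
Proof.
move=> fl; elim: r => [|i r IHr].
  rewrite big_nil (_ : (fun q => _) = cst 0); first exact: has_deriv_in_cst.
  by apply/funext => q; rewrite big_nil.
rewrite big_cons (_ : (fun q => _) = f i \+ (fun q => \sum_(i <- r) f i q)).
  exact: has_deriv_inD.
by apply/funext => q; rewrite big_cons.
Qed.

Lemma has_deriv_inZ (k : R) f p v l :
  has_deriv_in A f p v l -> has_deriv_in A (fun q => k *: f q) p v (k *: l).
Proof.
move=> fl; rewrite /has_deriv_in.
have -> : (fun h : R => h^-1 *: (k *: f (p + h *: v) - k *: f p)) =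
    (fun h : R => k *: (h^-1 *: (f (p + h *: v) - f p))).
  by apply/funext => h /=; rewrite -scalerBr !scalerA mulrC.
by apply: cvgZ => //; exact: cvg_cst.
Qed.

(** The value at [p + h *: v] is [f p] plus [h] times the difference quotient, which converges. *)
Lemma has_deriv_in_cvg f p v l :
  has_deriv_in A f p v l -> (fun h : R => f (p + h *: v)) @ along A p v --> f p.
Proof.
move=> fl.
have H : (fun h : R => f p + h *: (h^-1 *: (f (p + h *: v) - f p)))
    @ along A p v --> f p.
  rewrite -[X in _ --> X]addr0 -(scale0r l).
  apply: cvgD; first exact: cvg_cst.
  by apply: cvgZ => //; exact: cvg_along0.
apply: cvg_trans H; apply: near_eq_cvg; near=> h.
rewrite scalerA divff ?scale1r; first by rewrite addrC subrK.
near: h; exact: near_along_neq0.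
Unshelve. all: by end_near. Qed.

(** Leibniz rule for a linear scalar factor, whose difference quotient is constantly [phi v]. It
    serves for the factors $u^j$ of $\sigma$. *)
Lemma has_deriv_in_linearM (phi : P -> R) f p v l :
  {morph phi : x y / x + y} -> (forall h x, phi (h *: x) = h * phi x) ->
  has_deriv_in A f p v l ->
  has_deriv_in A (fun q => phi q *: f q) p v (phi p *: l + phi v *: f p).
Proof.
move=> phiD phiZ fl.
have H : (fun h : R => phi p *: (h^-1 *: (f (p + h *: v) - f p))
                       + phi v *: f (p + h *: v)) @ along A p v
         --> phi p *: l + phi v *: f p.
  apply: cvgD; apply: cvgZ; rewrite //; try exact: cvg_cst.
  exact: has_deriv_in_cvg fl.
apply: cvg_trans H; apply: near_eq_cvg; near=> h.
have h0 : h != 0 by near: h; exact: near_along_neq0.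
rewrite phiD phiZ [in RHS]scalerDl addrAC -scalerBr [in RHS]scalerDr !scalerA.
by rewrite mulrA mulVf // mul1r [in LHS]mulrC.
Unshelve. all: by end_near. Qed.

(** For [s] = 0 the quotients vanish identically; otherwise substitute [h * s] for [h]. *)
Lemma has_deriv_in_scale f p v l (s : R) :
  has_deriv_in A f p v l -> has_deriv_in A f p (s *: v) (s *: l).
Proof.
have [->|s0] := eqVneq s 0.
  move=> _; rewrite !scale0r /has_deriv_in.
  have -> : (fun h : R => h^-1 *: (f (p + h *: (0 : P)) - f p)) = cst 0.
    by apply/funext => h; rewrite scaler0 addr0 subrr scaler0.
  exact: cvg_cst.
move=> fl.
have sub : ( *%R^~ s) @ along A p (s *: v) --> along A p v.
  move=> B [/= e e0 He].
  have : \forall h \near along A p (s *: v), `|h * s| < e.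
    have : (fun h : R => h * s) @ along A p (s *: v) --> (0 : R).
      by rewrite -[X in _ --> X](mul0r s); apply: cvgM; [exact: cvg_along0|exact: cvg_cst].
    by move/cvgr0_norm_lt; exact.
  move=> near_e.
  suff : \forall h \near along A p (s *: v), B (h * s) by [].
  near=> h => /=; apply: He => /=.
  - rewrite /ball_ /= sub0r normrN; near: h; exact: near_e.
  - rewrite mulf_neq0 //; near: h; exact: near_along_neq0.
  - rewrite -scalerA; near: h; exact: near_along.
have H : (fun h : R => s *: ((h * s)^-1 *: (f (p + (h * s) *: v) - f p)))
    @ along A p (s *: v) --> s *: l.
  apply: cvgZ; first exact: cvg_cst.
  exact: (cvg_comp _ _ sub fl).
apply: cvg_trans H; apply: near_eq_cvg; near=> h.
rewrite !scalerA invfM mulrCA divff // mulr1 //.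
Unshelve. all: by end_near. Qed.

End Rules.

(** For linear [phi] the difference quotients of the composite are those of [f] with the same [h],
    so only the two filters have to be compared. *)
Lemma has_deriv_in_comp (P P' Q : normedModType R) (A : set P) (A' : set P')
    (f : P -> Q) (phi : P' -> P) p v l :
  {morph phi : x y / x + y} -> (forall h x, phi (h *: x) = h *: phi x) ->
  (forall q, A' q -> A (phi q)) ->
  has_deriv_in A f (phi p) (phi v) l -> has_deriv_in A' (f \o phi) p v l.
Proof.
move=> phiD phiZ sub fl.
have cphi : along A' p v `=>` along A (phi p) (phi v).
  rewrite /along => B; rewrite /within /=; apply: filterS => h H /sub.
  by rewrite phiD phiZ; exact: H.
rewrite /has_deriv_in (_ : (fun h : R => _) =
    (fun h : R => h^-1 *: (f (phi p + h *: phi v) - f (phi p)))).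
  by apply: cvg_trans fl; exact: cvg_app.
by apply/funext => h /=; rewrite phiD phiZ.
Qed.

Section Smooth.
Variables (P Q : normedModType R) (A : set P).
Hypothesis accA : accumulating A.
Implicit Types (f g : P -> Q) (p v : P) (l : Q).

(** Here [g] is a local extension as in [smooth_on]. Its two-sided limit restricts to the [h] with
    [p + h *: v] in [A], and for small [h] this point also lies in [U], where [f] and [g] agree on
    [A]. *)
Lemma derivable_has_deriv_in f g (U : set P) p v :
  open U -> U p -> A p -> {in A `&` U, f =1 g} -> derivable g p v ->
  has_deriv_in A f p v ('D_v g p).
Proof.
move=> oU Up Ap fg dg.
have nU : \forall h \near along A p v, U (p + h *: v).
  by apply: cvg_along; exact: open_nbhs_nbhs.
have : (fun h : R => h^-1 *: (g (p + h *: v) - g p)) @ along A p v --> 'D_v g p.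
  apply: cvg_within_filter.
  rewrite (_ : (fun h : R => h^-1 *: (g (p + h *: v) - g p)) =
    (fun h => h^-1 *: ((g \o shift p) (h *: v) - g p))); first exact: dg.
  by apply/funext => h /=; rewrite (addrC p).
apply: cvg_trans; apply: near_eq_cvg; near=> h.
rewrite !fg ?inE //; split; near: h => //; exact: near_along.
Unshelve. all: by end_near. Qed.

Lemma smooth_has_deriv_in f p v : smooth_on A f -> A p ->
  has_deriv_in A f p v (deriv_in A f p v).
Proof.
move=> sf Ap; have [U [g [oU Up Cg fg]]] := sf p Ap.
have H : has_deriv_in A f p v ('D_v g p).
  apply: (@derivable_has_deriv_in _ _ U) => //.
    by move=> q; rewrite inE => -[]; exact: fg.
  by have [_ /(_ v)[+ _]] := Cg 1; exact.
by rewrite (has_deriv_inE accA Ap H).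
Qed.

(** If [g] extends [f] locally, then ['D_v g] extends the derivative of [f] inside [A]. *)
Lemma smooth_deriv_in f v : smooth_on A f -> smooth_on A (deriv_in A f ^~ v).
Proof.
move=> sf p Ap; have [U [g [oU Up Cg fg]]] := sf p Ap.
exists U, ('D_v g); split => // [k|q Aq Uq].
  by have [_ /(_ v)[]] := Cg k.+1.
apply: has_deriv_inE => //; apply: (@derivable_has_deriv_in _ _ U) => //.
  by move=> r; rewrite inE => -[]; exact: fg.
by have [_ /(_ v)[+ _]] := Cg 1; exact.
Qed.

Lemma smooth_cvg_along f p v : smooth_on A f -> A p ->
  (fun h : R => f (p + h *: v)) @ along A p v --> f p.
Proof. move=> sf Ap; apply: has_deriv_in_cvg. exact: smooth_has_deriv_in. Qed.

End Smooth.
End DirectionalDerivatives.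

(** * Intervals, boxes and star-shaped sets *)

Section IntervalsAndBoxes.
Set Implicit Arguments.
Unset Strict Implicit.
Variable R : realType.

(** It suffices that a short segment from [p] along the line of [v] lies in [A]. The sign of [c]
    allows for boundary points, where only one of the two sides may be available. *)
Lemma accumulatingP (P : normedModType R) (A : set P) :
  (forall p v, A p ->
     exists2 c : R, c != 0 & \forall x \near 0^'+, A (p + (x * c) *: v)) ->
  accumulating A.
Proof.
move=> H p v Ap; have [c c0 nA] := H p v Ap.
have sub : (fun x => x * c) @ 0^'+ `=>` along A p v.
  move=> B [/= e e0 He].
  have near_e : \forall x \near 0^'+, `|x * c| < e.
    have : (fun x : R => x * c) @ 0^'+ --> (0 : R).
      rewrite -[X in _ --> X](mul0r c); apply: cvgM; last exact: cvg_cst.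
      exact: cvg_at_right_filter.
    by move/cvgr0_norm_lt; exact.
  suff : \forall x \near 0^'+, B (x * c) by [].
  near=> x => /=; apply: He => /=.
  - rewrite /ball_ /= sub0r normrN; near: x; exact: near_e.
  - by rewrite mulf_neq0.
  - by near: x.
apply: Build_ProperFilter_ex => B /sub /filter_ex [x Bx].
by exists x.
Unshelve. all: by end_near. Qed.

Lemma closed_interval_is_interval (a b : \bar R) : is_interval (closed_interval a b).
Proof.
move=> x y [ax _] [_ yb] z /andP[xz zy]; split.
  by apply: le_trans ax _; rewrite lee_fin.
by apply: le_trans yb; rewrite lee_fin.
Qed.

Lemma closed_interval_neq0 (a b : \bar R) : (a < b)%E -> closed_interval a b !=set0.
Proof.
case: a b => [r||] [s||] //= ab.
- by exists r; split; rewrite ?lexx // ltW.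
- by exists r; split; rewrite ?lexx // leey.
- by exists s; split; rewrite ?lexx // leNye.
- by exists 0; split; rewrite ?leey ?leNye.
Qed.

Lemma closed_interval_nonisolated (a b : \bar R) (t : R^o) : (a < b)%E ->
  closed_interval a b t -> exists2 s, s != t & closed_interval a b s.
Proof.
move=> ab [ta tb].
have [tb'|bt] := ltP t%:E b.
  case: b ab tb tb' => [r||] //= ab tb tb'.
    exists r; first by move: tb'; rewrite lte_fin => /gt_eqF ->.
    by split; [exact: le_trans ta tb|exact: lexx].
  exists (t + 1); first by rewrite gt_eqF // ltrDl.
  by split; rewrite ?leey // (le_trans ta) // lee_fin lerDl.
have {}bt : b = t%:E by apply/eqP; rewrite eq_le bt tb.
case: a ab ta => [r||] //= ab ta.
  exists r; first by move: ab; rewrite bt lte_fin => /lt_eqF ->.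
  by split; [exact: lexx|exact: ltW].
exists (t - 1); first by rewrite lt_eqF // ltrBlDr ltrDl.
by split; rewrite ?leNye // bt lee_fin lerBlDr lerDl.
Qed.

(** Choose [c] so that [c * s] is the step from [t] to another point of the interval; convexity
    keeps the points in between inside. *)
Lemma closed_interval_direction (a b : \bar R) (t : R^o) (s : R) : (a < b)%E ->
  closed_interval a b t ->
  exists2 c : R, c != 0 &
    \forall x \near 0^'+, closed_interval a b (t + (x * c) * s).
Proof.
move=> ab It; have [->|s0] := eqVneq s 0.
  by exists 1; rewrite ?oner_eq0 //; near=> x; rewrite mulr0 addr0.
have [t' t't It'] := closed_interval_nonisolated ab It.
have e0 : t' - t != 0 by rewrite subr_eq0.
exists ((t' - t) / s); first by rewrite mulf_neq0 // invr_eq0.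
near=> x; rewrite -mulrA divfK //.
have x0 : 0 < x by near: x; exact: nbhs_right_gt.
have x1 : x < 1 by near: x; apply: nbhs_right_lt.
move: t't; rewrite neq_lt => /orP[tt|tt].
  apply: (closed_interval_is_interval It' It); nra.
apply: (closed_interval_is_interval It It'); nra.
Unshelve. all: by end_near. Qed.

Lemma closed_interval_interior (a b : \bar R) : (a < b)%E ->
  (interior (closed_interval a b : set R)) !=set0.
Proof.
move=> ab; have [x Ix] := closed_interval_neq0 ab.
have [y yx Iy] := closed_interval_nonisolated ab Ix.
wlog xy : x y Ix Iy {yx} / x < y.
  by move=> H; move: yx; rewrite neq_lt => /orP[] /H; apply.
exists ((x + y) / 2).
apply: (@filterS _ _ _ `]x, y[%classic).
  by move=> z /=; rewrite in_itv /= => /andP[xz zy];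
    apply: (closed_interval_is_interval Ix Iy); rewrite !ltW.
apply: open_nbhs_nbhs; split; first exact: interval_open.
by rewrite /= in_itv /=; apply/andP; split; lra.
Qed.

Lemma open_box_open k (c d : 'I_k -> \bar R) : open (open_box c d).
Proof.
rewrite openE => u Hu.
suff : \forall v \near nbhs (u : 'rV[R]_k), forall j,
  (c j < ((v : 'rV[R]_k) 0 j)%:E)%E /\ (((v : 'rV[R]_k) 0 j)%:E < d j)%E by [].
apply: filter_forall => j; have [cu ud] := Hu j.
have cj := @coord_continuous R 1 k 0 j u.
have lo : nbhs (u 0 j) [set r | (c j < r%:E)%E].
  by apply: open_nbhs_nbhs; split => //; exact: open_ereal_gt.
have hi : nbhs (u 0 j) [set r | (r%:E < d j)%E].
  by apply: open_nbhs_nbhs; split => //; exact: open_ereal_lt.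
have nlo : nbhs u [set v : 'rV[R]_k | (c j < (v 0 j)%:E)%E] := cj _ lo.
have nhi : nbhs u [set v : 'rV[R]_k | ((v 0 j)%:E < d j)%E] := cj _ hi.
exact: filterI nlo nhi.
Qed.

(** The box is star-shaped about the origin, which makes the rulings connected. The sign of each
    coordinate decides which of its bounds comes from [u] and which from 0. *)
Lemma open_boxZ k (c d : 'I_k -> \bar R) u (s : R) : open_box c d 0 ->
  open_box c d u -> 0 <= s <= 1 -> open_box c d (s *: u).
Proof.
move=> H0 Hu /andP[s0 s1] j; have [c0 d0] := H0 j; have [cu du] := Hu j.
rewrite mxE in c0 d0; rewrite mxE.
have [u0|u0] := leP 0 (u 0 j); split.
- by apply: (lt_le_trans c0); rewrite lee_fin mulr_ge0.
- by apply: (le_lt_trans _ du); rewrite lee_fin ler_piMl.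
- by apply: (lt_le_trans cu); rewrite lee_fin ler_niMl // ltW.
- by apply: (le_lt_trans _ d0); rewrite lee_fin mulr_ge0_le0 // ltW.
Qed.

Lemma accumulating_interval (a b : \bar R) : (a < b)%E ->
  accumulating (closed_interval a b).
Proof.
move=> ab; apply: accumulatingP => t s It.
exact: closed_interval_direction.
Qed.

Lemma accumulating_prod (P : normedModType R) (a b : \bar R) (U : set P) :
  (a < b)%E -> open U -> accumulating (closed_interval a b `*` U).
Proof.
move=> ab oU; apply: accumulatingP => -[t u] [s w] [/= It Uu].
have [c c0 nI] := closed_interval_direction s ab It; exists c => //.
have cxc : (fun x : R => x * c) @ 0^'+ --> (0 : R).
  rewrite -[X in _ --> X](mul0r c); apply: cvgM; last exact: cvg_cst.
  exact: cvg_at_right_filter.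
have cvgu : (fun x : R => u + (x * c) *: w) @ 0^'+ --> u.
  rewrite -[X in _ --> X]addr0 -(scale0r w).
  by apply: cvgD; [exact: cvg_cst|exact: cvgZr_tmp].
have nU : \forall x \near 0^'+, U (u + (x * c) *: w).
  by apply: cvgu; exact: open_nbhs_nbhs.
by near=> x; split => /=; near: x.
Unshelve. all: by end_near. Qed.

(** [L] is a union of segments that all contain [x0]. *)
Lemma star_shaped_connected (Q : normedModType R) (L : set Q) (x0 : Q) :
  L x0 ->
  (forall x (s : R), L x -> 0 <= s <= 1 -> L (x0 + s *: (x - x0))) ->
  connected L.
Proof.
move=> L0 HL.
have -> : L = \bigcup_(x in L) ((fun s : R => x0 + s *: (x - x0)) @` `[0, 1]).
  apply/seteqP; split => [x Lx|x [y Ly [s]]].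
    by exists x => //; exists 1; rewrite /= ?in_itv /= ?lexx ?ler01 ?scale1r 1?addrC ?subrK.
  by rewrite /= in_itv /= => s01 <-; exact: HL.
apply: bigcup_connected.
  exists x0 => x Lx; exists 0; rewrite /= ?in_itv /= ?lexx ?ler01 //.
  by rewrite scale0r addr0.
move=> x Lx; apply: connected_continuous_connected; first exact: segment_connected.
apply: continuous_subspaceT => s.
apply: cvgD; first exact: cvg_cst.
by apply: cvgZr_tmp; exact: cvg_id.
Qed.

End IntervalsAndBoxes.

(** * Vanishing of the second fundamental form, in a frame of the tangent spaces *)

Section SecondFundamentalFormFrame.
Set Implicit Arguments.
Unset Strict Implicit.
Variables (R : realType) (N : nat).
Local Notation E := 'rV[R]_N.

(** Each coordinate of the product is a finite sum of products of coordinates of the factors. *)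
Lemma cvg_wedge_vec (T : Type) (F : set_system T) {FF : Filter F}
    (z : T -> E) (z0 : E) (x : T -> ext R N) (x0 : ext R N) :
  z @ F --> z0 -> (forall S, (fun h => x h S : R) @ F --> (x0 S : R)) ->
  forall S, (fun h => wedge (ext_vec (z h)) (x h) S : R) @ F -->
    (wedge (ext_vec z0) x0 S : R).
Proof.
move=> cz cx S; rewrite wedge_vecE.
under eq_fun do rewrite wedge_vecE.
apply: cvg_big => //; first exact: add_continuous.
move=> i _; apply: cvgM => //; apply: cvgM; first exact: cvg_cst.
exact: (cvg_comp _ _ cz (@coord_continuous _ _ _ 0 i z0)).
Qed.

Lemma cvg_wedge_seq (T I : Type) (F : set_system T) {FF : Filter F}
    (g : I -> T -> E) (l : I -> E) (s : seq I) :
  (forall i, g i @ F --> l i) ->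
  forall S, (fun h => wedge_seq [seq g i h | i <- s] S : R) @ F -->
    (wedge_seq [seq l i | i <- s] S : R).
Proof.
move=> gl; elim: s => [|i s IHs] S /=; first exact: cvg_cst.
rewrite wedge_seq_cons; under eq_fun do rewrite wedge_seq_cons.
exact: cvg_wedge_vec.
Qed.

Variables (P : normedModType R) (A : set P) (f : P -> E) (vs : seq P).
Let frame q := [seq deriv_in A f q v | v <- vs].
Hypothesis accA : accumulating A.
Hypothesis smooth_f : smooth_on A f.
Hypothesis immersion_f : forall q, A q -> injective (deriv_in A f q).
Hypothesis free_frame : forall q, A q -> free (frame q).
Hypothesis tangent_frame :
  forall q, A q -> tangent_space A f q = [set x | x \in << frame q >>%VS].

(* The difference quotients of [Z] at a zero are tangent at nearby points, and
   tangency is the closed condition [wedge_seq (z :: frame) = 0]. *)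
Lemma tangent_deriv_in0 (Z : P -> E) q v l : A q ->
  (forall p, A p -> tangent_space A f p (Z p)) -> Z q = 0 ->
  has_deriv_in A Z q v l -> tangent_space A f q l.
Proof.
move=> Aq ZT Zq0 dZ; rewrite tangent_frame //=.
have FF := accA v Aq.
apply/(wedge_seq_span _ (free_frame Aq))/ffunP => S.
rewrite wedge_seq_cons.
have cvgf S' : (fun h => wedge_seq (frame (q + h *: v)) S' : R) @ along A q v -->
    (wedge_seq (frame q) S' : R).
  apply: cvg_wedge_seq => w.
  apply: (@smooth_cvg_along _ _ _ _ accA (fun p => deriv_in A f p w)) => //.
  exact: smooth_deriv_in.
have := @cvg_wedge_vec _ _ _ _ _ _ _ dZ cvgf S.
move=> /(_ _)/cvg_lim => <- //; rewrite ffunE.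
apply/cvg_lim => //; apply: (@cvg_trans _ (cst (0 : R) @ along A q v)); last exact: cvg_cst.
apply: near_eq_cvg; near=> h.
have Ah : A (q + h *: v) by near: h; exact: near_along.
have := ZT _ Ah; rewrite Zq0 subr0 tangent_frame //= => Zh.
have : h^-1 *: Z (q + h *: v) \in << frame (q + h *: v)%R >>%VS by exact: rpredZ.
move/(wedge_seq_span _ (free_frame Ah)).
by rewrite wedge_seq_cons => ->; rewrite ffunE.
Unshelve. all: by end_near. Qed.

(** The field [deriv_in A f ^~ v'] is one admissible choice of tangent field. Any other choice
    differs from it by a tangent field vanishing at [q], whose derivative is tangent by
    [tangent_deriv_in0], so tangency of the derivative does not depend on the choice. *)
Lemma second_fundamental_form_eq0 q v v' : A q ->
  second_fundamental_form A f q (deriv_in A f q v) (deriv_in A f q v') = 0 <->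
  tangent_space A f q (deriv_in A (deriv_in A f ^~ v') q v).
Proof.
move=> Aq.
set Y' := deriv_in A f ^~ v'.
have TD x y : tangent_space A f q x -> tangent_space A f q y ->
    tangent_space A f q (x + y).
  by rewrite tangent_frame //=; exact: rpredD.
have TN x : tangent_space A f q x -> tangent_space A f q (- x).
  by rewrite tangent_frame //= rpredN.
have T0 : tangent_space A f q 0 by rewrite tangent_frame //= mem0v.
have smY' : smooth_on A Y' by exact: smooth_deriv_in.
have dY' := smooth_has_deriv_in accA (v := v) smY' Aq.
have key Y : tangent_field A f Y -> Y q = Y' q ->
    tangent_space A f q (deriv_in A Y q v - deriv_in A Y' q v).
  move=> [smY YT] Yq.
  have dY := smooth_has_deriv_in accA (v := v) smY Aq.
  apply: (@tangent_deriv_in0 (fun p => Y p + (- 1) *: Y' p) q v) => //.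
  - move=> p Ap; have := YT p Ap; rewrite tangent_frame //= => Yp.
    rewrite rpredD // rpredZ //.
    have : tangent_space A f p (Y' p) by exists v'.
    by rewrite tangent_frame.
  - by rewrite scaleN1r Yq subrr.
  - apply: has_deriv_inD => //; rewrite -[X in has_deriv_in _ _ _ _ X]scaleN1r.
    exact: has_deriv_inZ.
rewrite /second_fundamental_form.
case: xgetP => [w _ [v0 [Y [v0E Yt Yq [wT wn]]]]|noex].
  (* The witness selected by [xget] comes with its own direction [v0]; the immersion property
     identifies it with [v]. *)
  move: v0E => /(immersion_f Aq) v0E; rewrite v0E in wn.
  have {}key := key Y Yt Yq.
  split=> [w0|YT].
    move: wn; rewrite w0 subr0 => wn.
    by rewrite -(subKr (deriv_in A Y q v) (deriv_in A Y' q v)); apply: TD => //; exact: TN.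
  (* Here [w] is both normal and tangent, hence orthogonal to itself. *)
  apply/eqP; rewrite -dotp_eq0; apply/eqP; apply: wT.
  rewrite -(subKr (deriv_in A Y q v) w); apply: (TD); last exact: TN.
  by rewrite -[deriv_in A Y q v](subrK (deriv_in A Y' q v)); exact: TD.
(* The default value of [xget] never occurs: the normal component of the derivative of [Y'] is a
   witness. *)
exfalso.
have [w [wT wn]] := orth_decomposition << frame q >>%VS (deriv_in A Y' q v).
apply: (noex w); exists v, Y'; split=> //.
  by split=> // p Ap; exists v'.
by split=> [y|]; rewrite tangent_frame //=; exact: wT.
Qed.

End SecondFundamentalFormFrame.

(** * Linear algebra and first derivatives of ruled parametrizations *)

Section RuledParam.
Set Implicit Arguments.
Unset Strict Implicit.
Variables (R : realType) (N k : nat).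
Local Notation E := 'rV[R]_N.

Lemma sum_delta (Q : lmodType R) (x : 'I_k -> Q) j :
  \sum_(i < k) (delta_mx 0 j : 'rV[R]_k) 0 i *: x i = x j.
Proof.
rewrite (bigD1 j) //= mxE !eqxx scale1r big1 ?addr0 // => i /negbTE ij.
by rewrite mxE ij andbF scale0r.
Qed.

Lemma mem_span_family (x : 'I_k -> E) z :
  reflect (exists w : 'rV[R]_k, z = \sum_(j < k) w 0 j *: x j)
    (z \in << [seq x j | j <- enum 'I_k] >>%VS).
Proof.
have xE : [seq x j | j <- enum 'I_k] = [tuple x j | j < k] by [].
apply: (iffP idP) => [|[w ->]].
  rewrite xE => /coord_span ->.
  exists (\row_j coord [tuple x j | j < k] j z).
  by apply: eq_bigr => j _; rewrite mxE -tnth_nth tnth_mktuple.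
apply: rpred_sum => j _; apply: rpredZ; apply: memv_span.
by apply: map_f; rewrite mem_enum.
Qed.

Lemma mem_span_cons_family e0 (x : 'I_k -> E) z :
  reflect (exists s (w : 'rV[R]_k), z = s *: e0 + \sum_(j < k) w 0 j *: x j)
    (z \in << e0 :: [seq x j | j <- enum 'I_k] >>%VS).
Proof.
rewrite span_cons.
apply: (iffP memv_addP) => [[_ /vlineP[s ->]] [_ /mem_span_family[w ->] ->]|].
  by exists s, w.
move=> [s [w ->]]; exists (s *: e0); first by rewrite rpredZ // memv_line.
by exists (\sum_(j < k) w 0 j *: x j) => //; apply/mem_span_family; exists w.
Qed.

(* The symmetric bilinear form is the second derivative of a ruled
   parametrization modulo the tangent space [T], with [C] and [y j] the
   derivatives in the directions (t, t) and (t, u_j). *)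
Lemma nullity_dim (e0 C : E) (x y : 'I_k -> E)
    (lc := fun s (w : 'rV[R]_k) => s *: e0 + \sum_(j < k) w 0 j *: x j)
    (T := << e0 :: [seq x j | j <- enum 'I_k] >>%VS)
    (Nul := [set z | exists s w, z = lc s w /\
      forall s' (w' : 'rV[R]_k), (s * s') *: C + s *: (\sum_(j < k) w' 0 j *: y j)
                + s' *: (\sum_(j < k) w 0 j *: y j) \in T]) :
  (forall s w s' w', lc s w = lc s' w' -> s = s' /\ w = w') ->
  free [seq x j | j <- enum 'I_k] ->
  (exists2 W : {vspace E}, \dim W = k & Nul = [set z | z \in W]) <->
  (forall j, y j \in T) /\ C \notin T.
Proof.
move=> inj freex.
have lc0 w : lc 0 w = \sum_(j < k) w 0 j *: x j by rewrite /lc scale0r add0r.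
have dimX : \dim << [seq x j | j <- enum 'I_k] >> = k.
  by move: freex; rewrite /free size_map size_enum_ord => /eqP.
have e0X : e0 \notin << [seq x j | j <- enum 'I_k] >>%VS.
  apply/negP => /mem_span_family[w e0w].
  have [/eqP] : (1 : R) = 0 /\ (0 : 'rV[R]_k) = w.
    apply: inj; rewrite lc0 -e0w /lc scale1r big1 ?addr0 // => j _.
    by rewrite mxE scale0r.
  by rewrite oner_eq0.
have dimT : \dim T = k.+1.
  have : free (e0 :: [seq x j | j <- enum 'I_k]) by rewrite free_cons e0X.
  by rewrite /free /= size_map size_enum_ord => /eqP.
have sum0 (z : 'I_k -> E) : \sum_(j < k) (0 : 'rV[R]_k) 0 j *: z j = 0.
  by rewrite big1 // => j _; rewrite mxE scale0r.
split=> [[W dimW NulW]|[yT CT]]; last first.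
  exists << [seq x j | j <- enum 'I_k] >>%VS => //.
  have sumT w : \sum_(j < k) w 0 j *: y j \in T.
    by apply: rpred_sum => j _; apply: rpredZ.
  (* Pairing with the direction $t$ leaves [s *: C] modulo [T], and [C] is not in [T], so [s] =
     0. *)
  apply/seteqP; split => [z [s [w [-> /(_ 1 0)]]]|z /= /mem_span_family[w ->]].
    rewrite sum0 scaler0 addr0 mulr1 scale1r rpredDr // => sC.
    have [->|s0] := eqVneq s 0; first by rewrite lc0; apply/mem_span_family; exists w.
    by move: CT; rewrite -(scalerK s0 C) rpredZ.
  exists 0, w; rewrite lc0; split=> // s' w'.
  by rewrite mul0r !scale0r !add0r rpredZ.
(* Otherwise pairing with the direction $u_j$ forces [s] = 0 on the nullity space, which by
   dimension is then the span of the [x j]. But pairing [x j] with the direction $t$ gives [y j]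
   back, a contradiction. *)
have yT j : y j \in T.
  apply: contraT => yjT.
  have WX : (W <= << [seq x j | j <- enum 'I_k] >>)%VS.
    apply/subvP => z zW; have : Nul z by rewrite NulW.
    move=> [s [w [-> /(_ 0 (delta_mx 0 j))]]].
    rewrite sum_delta mulr0 !scale0r add0r addr0 => sy.
    have [->|s0] := eqVneq s 0; first by rewrite lc0; apply/mem_span_family; exists w.
    by move: yjT; rewrite -(scalerK s0 (y j)) rpredZ.
  have /eqP WE : W == << [seq x j | j <- enum 'I_k] >>%VS.
    by rewrite eqEdim WX dimX dimW leqnn.
  have : Nul (x j).
    by rewrite NulW /= WE; apply: memv_span; apply: map_f; rewrite mem_enum.
  move=> [s [w [xj /(_ 1 0)]]].
  have [<- <-] : (0 : R) = s /\ (delta_mx 0 j : 'rV[R]_k) = w by apply: inj; rewrite lc0 sum_delta.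
  by rewrite sum_delta mul0r !scale0r !add0r scale1r (negbTE yjT).
split=> //; apply/negP => CT.
(* With [C] and all [y j] in [T] the form vanishes, so the nullity space contains [T], whose
   dimension [k.+1] is too large. *)
have : (T <= W)%VS.
  apply/subvP => z /mem_span_cons_family[s [w zE]].
  suff : Nul z by rewrite NulW.
  exists s, w; split=> // s' w'.
  have sumT w'' : \sum_(j < k) w'' 0 j *: y j \in T.
    by apply: rpred_sum => i _; apply: rpredZ.
  by rewrite !rpredD // rpredZ.
by move/dimvS; rewrite dimT dimW ltnn.
Qed.

Section Derivatives.
Variables (a b : \bar R) (U : set 'rV[R]_k).
Local Notation I := (closed_interval a b).

(** Stated for arbitrary [g] and [Y] because the first derivatives of $\sigma$ are again of this
    shape, so that the lemma also yields the second derivatives. *)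
Lemma has_deriv_in_ruled_param (g : R^o -> E) (Y : 'I_k -> R^o -> E) dg dY
    (t s : R^o) (u w : 'rV[R]_k) :
  has_deriv_in I g t 1 dg -> (forall j, has_deriv_in I (Y j) t 1 (dY j)) ->
  has_deriv_in (I `*` U) (ruled_param g Y) (t, u) (s, w)
    (s *: (dg + \sum_(j < k) u 0 j *: dY j) + \sum_(j < k) w 0 j *: Y j t).
Proof.
move=> Hg HY.
have Hfst (f : R^o -> E) l : has_deriv_in I f t 1 l ->
    has_deriv_in (I `*` U) (fun q => f q.1) (t, u) (s, w) (s *: l).
  move=> Hf; apply: (@has_deriv_in_comp _ _ _ _ I _ f fst) => //=; last first.
    by have := has_deriv_in_scale (s := s) Hf; rewrite [_ *: 1]mulr1.
  by move=> q [].
rewrite scalerDr scaler_sumr -addrA -big_split /=.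
apply: has_deriv_inD; first exact: Hfst.
apply: has_deriv_in_sum => j.
rewrite scalerA mulrC -scalerA.
apply: (@has_deriv_in_linearM _ _ _ _ (fun q : R^o * 'rV[R]_k => q.2 0 j)
  (fun q => Y j q.1) (t, u) (s, w)) => [x y|h x|]; try by rewrite /= mxE.
exact: Hfst.
Qed.

End Derivatives.
End RuledParam.

(** * Open subsets of affine subspaces *)

Section AffineLeaves.
Set Implicit Arguments.
Unset Strict Implicit.
Variables (R : realType) (N : nat).
Local Notation E := 'rV[R]_N.

Lemma row_linear_continuous (Q : normedModType R) (phi : E -> Q) :
  {morph phi : x y / x + y} -> (forall h x, phi (h *: x) = h *: phi x) ->
  continuous phi.
Proof.
move=> phiD phiZ.
have phi0 : phi 0 = 0 by rewrite -(scale0r 0) phiZ scale0r.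
pose l i := phi (delta_mx 0 i).
have phiE : phi = fun x : E => \sum_(i < N) x 0 i *: l i.
  apply/funext => x; rewrite {1}(row_sum_delta x) (big_morph phi phiD phi0).
  by apply: eq_bigr => i _; rewrite phiZ.
have cvg_phi (F : set_system E) (z : E) : Filter F ->
    (forall i, (fun x : E => x 0 i) @ F --> z 0 i) -> phi @ F --> phi z.
  move=> FF cz; rewrite phiE.
  apply: cvg_big => //; first exact: add_continuous.
  by move=> i _; apply: cvgZr_tmp; exact: cz.
by move=> z; apply: (cvg_phi (nbhs (z : E)) z _ (fun i => @coord_continuous _ _ _ 0 i z)).
Qed.

(** The coordinates with respect to the family extend to a linear, hence continuous, map on all of
    [E]. The preimage of [U] under it, translated by [x0], is the open set that cuts out the
    image. *)
Lemma open_affine_image k (x0 : E) (x : 'I_k -> E) (U : set 'rV[R]_k) :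
  free [seq x j | j <- enum 'I_k] -> open U ->
  open_in_affine_subspace k [set x0 + \sum_(j < k) u 0 j *: x j | u in U].
Proof.
move=> freex oU; pose xt : k.-tuple E := [tuple x j | j < k].
have freext : free xt by [].
have xtE (j : 'I_k) : xt`_j = x j by rewrite -tnth_nth tnth_mktuple.
pose phi (z : E) := \row_j coord xt j z.
have phiK (u : 'rV[R]_k) : phi (\sum_(j < k) u 0 j *: x j) = u.
  apply/rowP => j; rewrite mxE.
  by under eq_bigr => i _ do rewrite -xtE; rewrite coord_sum_free.
have contphi : continuous (fun z : E => phi (z - x0)).
  move=> z; apply: (@continuous_comp _ _ _ (fun z : E => z - x0) phi).
    by apply: (@continuousB _ _ _ id (cst x0) z); [move=> ? ?|exact: cst_continuous].
  apply: row_linear_continuous => [y y'|h y]; apply/rowP => j; rewrite !mxE.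
    by rewrite linearD.
  by rewrite linearZ.
exists x0, << [seq x j | j <- enum 'I_k] >>%VS, ((fun z : E => phi (z - x0)) @^-1` U).
split.
- by move: freex; rewrite /free size_map size_enum_ord => /eqP.
- by apply: open_comp => // z _; exact: contphi.
apply/seteqP; split => [_ [u Uu <-]|z [/= Uz /mem_span_family[u zE]]].
  by split; rewrite /= addrC addKr ?phiK //; apply/mem_span_family; exists u.
by exists u; [rewrite -(phiK u) -zE|rewrite -zE addrC subrK].
Qed.

End AffineLeaves.

(** * Planar points, rank one and rulings of the parametrized submanifold *)

Section RuledSubmanifold.
Set Implicit Arguments.
Unset Strict Implicit.
Variables (R : realType) (N m : nat) (a b : \bar R).
Local Notation E := 'rV[R]_N.
Local Notation k := m.-1.
Local Notation I := (closed_interval a b).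
Hypothesis ab : (a < b)%E.
Variables (gamma : R^o -> E) (X : 'I_k -> R^o -> E).
Hypothesis smooth_gamma : smooth_on I gamma.
Hypothesis smooth_X : forall j, smooth_on I (X j).
Variables (c d : 'I_k -> \bar R).
Local Notation V := (open_box c d).
Local Notation A := (I `*` V).
Local Notation sigma := (ruled_param gamma X).
Local Notation der f := (fun t : R^o => deriv_in I f t 1).
Local Notation Xs t := [seq X j t | j <- enum 'I_k].
Hypothesis V0 : V 0.
Hypothesis embedding_sigma : smooth_embedding A sigma.
Hypothesis free_X : forall t, I t -> free (Xs t).

Let e0 (t : R^o) (u : 'rV[R]_k) : E := der gamma t + \sum_(j < k) u 0 j *: der (X j) t.
Let T t u : {vspace E} := << e0 t u :: Xs t >>%VS.
Let C (t : R^o) (u : 'rV[R]_k) : E :=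
  der (der gamma) t + \sum_(j < k) u 0 j *: der (der (X j)) t.

Let accI : accumulating I := accumulating_interval ab.

Let accA : accumulating A.
Proof. by apply: accumulating_prod => //; exact: open_box_open. Qed.

Let deriv_sigma t u s w : I t -> V u ->
  deriv_in A sigma (t, u) (s, w) = s *: e0 t u + \sum_(j < k) w 0 j *: X j t.
Proof.
move=> It Vu; apply: has_deriv_inE => //; apply: has_deriv_in_ruled_param => [|j].
  exact: smooth_has_deriv_in.
exact: smooth_has_deriv_in.
Qed.

Let second_deriv_sigma t u s w s' w' : I t -> V u ->
  deriv_in A (deriv_in A sigma ^~ (s', w')) (t, u) (s, w) =
  (s * s') *: C t u + s *: (\sum_(j < k) w' 0 j *: der (X j) t)
    + s' *: (\sum_(j < k) w 0 j *: der (X j) t).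
Proof.
move=> It Vu; apply: has_deriv_inE => //.
have dX j := smooth_has_deriv_in accI (v := 1) (smooth_X j) It.
have dX' j := smooth_has_deriv_in accI (v := 1) (smooth_deriv_in accI 1 (smooth_X j)) It.
have dg' := smooth_has_deriv_in accI (v := 1) (smooth_deriv_in accI 1 smooth_gamma) It.
(* The derivative of [sigma] in the direction [(s', w')] is the ruled parametrization with base
   curve [g2] and ruling fields $s' X_j'$. *)
pose g2 t := s' *: der gamma t + \sum_(j < k) w' 0 j *: X j t.
apply: (@has_deriv_in_eq _ _ _ _ (ruled_param g2 (fun j t => s' *: der (X j) t))) => //.
  move=> -[r v]; rewrite inE => -[/= Ir Vv].
  rewrite deriv_sigma // /ruled_param /g2 /e0 /= scalerDr addrAC scaler_sumr.
  by congr (_ + _ + _); apply: eq_bigr => j _; rewrite !scalerA mulrC.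
have -> : (s * s') *: C t u + s *: (\sum_(j < k) w' 0 j *: der (X j) t)
    + s' *: (\sum_(j < k) w 0 j *: der (X j) t) =
  s *: ((s' *: der (der gamma) t + \sum_(j < k) w' 0 j *: der (X j) t)
    + \sum_(j < k) u 0 j *: (s' *: der (der (X j)) t))
    + \sum_(j < k) w 0 j *: (s' *: der (X j) t).
  congr (_ + _); last first.
    by rewrite scaler_sumr; apply: eq_bigr => j _; rewrite !scalerA mulrC.
  rewrite -scalerA -scalerDr; congr (_ *: _).
  rewrite /C scalerDr addrAC scaler_sumr; congr (_ + _ + _).
  by apply: eq_bigr => j _; rewrite !scalerA mulrC.
have dsX' j := has_deriv_inZ (k := s') (dX' j).
have dwX j := has_deriv_inZ (k := w' 0 j) (dX j).
have dg2 := has_deriv_inD (has_deriv_inZ (k := s') dg')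
  (has_deriv_in_sum (r := index_enum 'I_k) dwX).
have H := has_deriv_in_ruled_param V (s := s) (u := u) (w := w) dg2 dsX'.
exact: H.
Qed.

Let deriv_sigma_inj t u (s : R) (w : 'rV[R]_k) (s' : R) (w' : 'rV[R]_k) : I t -> V u ->
  s *: e0 t u + \sum_(j < k) w 0 j *: X j t =
  s' *: e0 t u + \sum_(j < k) w' 0 j *: X j t -> s = s' /\ w = w'.
Proof.
move=> It Vu; rewrite -!deriv_sigma //; have [_ imm _ _] := embedding_sigma.
by move=> /(imm (t, u) (conj It Vu)) [].
Qed.

(** The coordinate directions of $(t, u)$; their images form the frame needed for
    [second_fundamental_form_eq0]. *)
Let directions : seq (R^o * 'rV[R]_k) :=
  (1, 0) :: [seq (0, delta_mx 0 j) | j <- enum 'I_k].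

Let frame_sigma t u : I t -> V u ->
  [seq deriv_in A sigma (t, u) v | v <- directions] = e0 t u :: Xs t.
Proof.
move=> It Vu; rewrite /directions /= deriv_sigma // scale1r big1; last first.
  by move=> j _; rewrite mxE scale0r.
rewrite addr0 -map_comp; congr (_ :: _); apply: eq_map => j /=.
by rewrite deriv_sigma // scale0r add0r sum_delta.
Qed.

Let free_frame t u : I t -> V u -> free (e0 t u :: Xs t).
Proof.
move=> It Vu; rewrite free_cons free_X // andbT; apply/negP => /mem_span_family[w e0w].
have : (1 : R) = 0 /\ (0 : 'rV[R]_k) = w.
  apply: (deriv_sigma_inj It Vu); rewrite -e0w scale0r add0r scale1r big1 ?addr0 // => j _.
  by rewrite mxE scale0r.
by case=> /eqP; rewrite oner_eq0.
Qed.

Let tangent_sigma t u : I t -> V u ->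
  tangent_space A sigma (t, u) = [set z | z \in T t u].
Proof.
move=> It Vu; apply/seteqP; split => [z [[s w] _ <-]|z /= /mem_span_cons_family[s [w ->]]].
  by rewrite deriv_sigma //=; apply/mem_span_cons_family; exists s, w.
by exists (s, w) => //; rewrite deriv_sigma.
Qed.

Let sff_eq0 t u (s : R) (w : 'rV[R]_k) (s' : R) (w' : 'rV[R]_k) : I t -> V u ->
  second_fundamental_form A sigma (t, u)
    (deriv_in A sigma (t, u) (s, w)) (deriv_in A sigma (t, u) (s', w')) = 0 <->
  (s * s') *: C t u + s *: (\sum_(j < k) w' 0 j *: der (X j) t)
    + s' *: (\sum_(j < k) w 0 j *: der (X j) t) \in T t u.
Proof.
move=> It Vu; have [smooth_sigma imm _ _] := embedding_sigma.
rewrite (second_fundamental_form_eq0 accA smooth_sigma imm (vs := directions)) //.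
- by rewrite second_deriv_sigma // tangent_sigma.
- by move=> [r v] [Ir Vv]; rewrite frame_sigma //; exact: free_frame.
- by move=> [r v] [Ir Vv]; rewrite frame_sigma // tangent_sigma.
Qed.

(** The vectors listed are the entries of the form for $(t, t)$ and $(t, u_j)$; bilinearity covers
    all other arguments. *)
Lemma planar_pointP t u : I t -> V u ->
  planar_point A sigma (t, u) <-> C t u \in T t u /\ forall j, der (X j) t \in T t u.
Proof.
move=> It Vu.
have sum0 (z : 'I_k -> E) : \sum_(j < k) (0 : 'rV[R]_k) 0 j *: z j = 0.
  by rewrite big1 // => j _; rewrite mxE scale0r.
split=> [H|[CT XT] x y [[s w] _ <-] [[s' w'] _ <-]].
  have {}H s (w : 'rV[R]_k) s' (w' : 'rV[R]_k) :
      (s * s') *: C t u + s *: (\sum_(j < k) w' 0 j *: der (X j) t)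
      + s' *: (\sum_(j < k) w 0 j *: der (X j) t) \in T t u.
    by apply/(sff_eq0 s w s' w' It Vu); apply: H; [exists (s, w)|exists (s', w')].
  split=> [|j].
    by have := H 1 0 1 0; rewrite !sum0 !scaler0 !addr0 mulr1 scale1r.
  have := H 1 0 0 (delta_mx 0 j).
  by rewrite sum0 sum_delta mulr0 !scale0r addr0 add0r scale1r.
apply/(sff_eq0 s w s' w' It Vu).
have XT' (w'' : 'rV[R]_k) : \sum_(j < k) w'' 0 j *: der (X j) t \in T t u.
  by apply: rpred_sum => j _; exact: rpredZ.
by apply: rpredD; [apply: rpredD|]; apply: rpredZ; [exact: CT|exact: XT'|exact: XT'].
Qed.

(** Written in parameters, the nullity space is the set treated in [nullity_dim]. *)
Lemma rank_one_pointP t u : I t -> V u ->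
  (exists2 W : {vspace E}, \dim W = k &
     nullity_space A sigma (t, u) = [set z | z \in W]) <->
  (forall j, der (X j) t \in T t u) /\ C t u \notin T t u.
Proof.
move=> It Vu.
rewrite -(@nullity_dim _ _ _ _ (C t u) (fun j => X j t) (fun j => der (X j) t)); last 2 first.
- by move=> *; exact: (deriv_sigma_inj It Vu).
- exact: free_X.
suff -> : nullity_space A sigma (t, u) = [set z | exists s (w : 'rV[R]_k),
    z = s *: e0 t u + \sum_(j < k) w 0 j *: X j t /\
    forall s' (w' : 'rV[R]_k), (s * s') *: C t u
      + s *: (\sum_(j < k) w' 0 j *: der (X j) t)
      + s' *: (\sum_(j < k) w 0 j *: der (X j) t) \in T t u] by [].
apply/seteqP; split => [z [[[s w] _ <-] H]|z [s [w [-> H]]]].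
  exists s, w; rewrite deriv_sigma //; split=> // s' w'.
  by apply/(sff_eq0 s w s' w' It Vu); apply: H; exists (s', w').
rewrite -deriv_sigma //; split; first by exists (s, w).
by move=> _ [[s' w'] _ <-]; apply/(sff_eq0 s w s' w' It Vu); exact: H.
Qed.

Let ruling t := sigma @` ([set t] `*` V).

Let rulingE t : ruling t = [set gamma t + \sum_(j < k) u 0 j *: X j t | u in V].
Proof.
apply/seteqP; split => [_ [[_ u] [/= -> Vu] <-]|_ [u Vu <-]]; first by exists u.
by exists (t, u).
Qed.

Let rulings : set (set E) := [set L | exists2 t, I t & L = ruling t].

Lemma foliation_rulings : foliation m (sigma @` A) rulings.
Proof.
have [_ _ inj_sigma _] := embedding_sigma.
split.
- apply/seteqP; split => [z [_ [t It ->] [[_ u] [/= -> Vu] <-]]|_ [[t u] [/= It Vu] <-]].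
    by exists (t, u).
  by exists (ruling t); [exists t|exists (t, u)].
- move=> _ _ [t It ->] [t' It' ->] [z [[[_ u] [/= -> Vu] <-] [[_ u'] [/= -> Vu']]]].
  move/inj_sigma => H; suff [-> _] : (t', u') = (t, u) by [].
  by apply: H; rewrite inE.
- move=> _ [t It ->]; rewrite rulingE.
  have c0 : [set gamma t + \sum_(j < k) u 0 j *: X j t | u in V] (gamma t).
    by exists 0 => //; rewrite big1 ?addr0 // => j _; rewrite mxE scale0r.
  split; first by exists (gamma t).
  apply: (star_shaped_connected c0) => _ s [u Vu <-] s01.
  exists (s *: u); first exact: open_boxZ.
  rewrite (addrC (gamma t) (\sum_(j < k) u 0 j *: X j t)) addrK scaler_sumr.
  by congr (_ + _); apply: eq_bigr => j _; rewrite mxE scalerA.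
(* [sigma] itself is a global foliated chart, and its plaques are the rulings. *)
- move=> p Mp; exists I, V, setT, sigma; split.
  + by split; [exact: closed_interval_is_interval|exact: closed_interval_interior].
  + exact: open_box_open.
  + exact: embedding_sigma.
  + by split => //; [exact: openT|rewrite setIT].
  + by move=> t It; exists (ruling t) => //; exists t.
Qed.

(** The images of the slices {t} x V always form a foliation with affine leaves, so only planar
    points can prevent ruledness. *)
Lemma ruledP :
  ruled A sigma m <-> forall q, A q -> ~ planar_point A sigma q.
Proof.
split=> [[]//|nonplanar]; split=> //; exists rulings; split.
  exact: foliation_rulings.
move=> _ [t It ->]; rewrite rulingE; apply: open_affine_image; first exact: free_X.
exact: open_box_open.
Qed.

Let e0_0 t : e0 t 0 = der gamma t.
Proof. by rewrite /e0 big1 ?addr0 // => j _; rewrite mxE scale0r. Qed.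

Lemma rank_oneP : rank_one A sigma m <->
  ruled A sigma m /\ forall j t, I t -> der (X j) t \in T t 0.
Proof.
split=> [H|[/ruledP nonplanar XT] [t u] [/= It Vu]].
  have {}H t u : I t -> V u ->
      (forall j, der (X j) t \in T t u) /\ C t u \notin T t u.
    by move=> It Vu; apply/rank_one_pointP => //; exact: H.
  split=> [|j t It]; last by have [+ _] := H t 0 It V0; exact.
  apply/ruledP => -[t u] [/= It Vu] /(planar_pointP It Vu)[CT _].
  by have [_ /negP] := H t u It Vu.
apply/rank_one_pointP => //.
have XTu j : der (X j) t \in T t u.
  (* [e0 t u] differs from [e0 t 0] by a combination of the $X_j'$, which lie in [T t 0]. This gives
     one inclusion, and the dimensions agree because both frames are free. *)
  suff /eqP -> : T t u == T t 0 by exact: XT.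
  rewrite eqEdim; apply/andP; split.
    rewrite /T [X in (X <= _)%VS]span_cons subv_add; apply/andP; split.
      rewrite -memvE rpredD //.
        by rewrite -e0_0 memv_span // mem_head.
      by apply: rpred_sum => i _; apply: rpredZ; exact: XT.
    by rewrite span_cons addvSr.
  have dimT v : V v -> \dim (T t v) = size (e0 t v :: Xs t).
    by move=> Vv; apply/eqP; exact: free_frame.
  by rewrite !dimT.
split=> //; apply/negP => CT; apply: (nonplanar (t, u)) => //.
by apply/planar_pointP.
Qed.

End RuledSubmanifold.

(** * From tangency along $\gamma$ to the wedge product equations *)

Theorem corollary3p8 (R : realType) (m n : nat) (hm : (2 <= m)%N) (hn : (1 <= n)%N)
    (a b : \bar R) (hab : (a < b)%E)
    (gamma : R^o -> 'rV[R]_(m + n))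
    (hgamma : smooth_embedding (closed_interval a b) gamma)
    (X : 'I_m.-1 -> R^o -> 'rV[R]_(m + n))
    (hX : forall j, smooth_on (closed_interval a b) (X j))
    (hindep : forall t : R^o, closed_interval a b t ->
       wedge_seq (deriv_in (closed_interval a b) gamma t 1
                  :: [seq X i t | i <- enum 'I_m.-1]) <> 0)
    (c d : 'I_m.-1 -> \bar R) (hV : open_box c d 0)
    (hsigma : smooth_embedding
       ((closed_interval a b) `*` open_box c d) (ruled_param gamma X)) :
  rank_one ((closed_interval a b) `*` open_box c d) (ruled_param gamma X) m
  <->
  ruled ((closed_interval a b) `*` open_box c d) (ruled_param gamma X) m /\
  forall (j : 'I_m.-1) (t : R^o), closed_interval a b t ->
    wedge_seq [:: deriv_in (closed_interval a b) (X j) t 1,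
                  deriv_in (closed_interval a b) gamma t 1
                & [seq X i t | i <- enum 'I_m.-1]] = 0.
Proof.
have free_gX t : closed_interval a b t ->
    free (deriv_in (closed_interval a b) gamma t 1 :: [seq X i t | i <- enum 'I_m.-1]).
  by move=> It; apply/wedge_seq_free; exact: hindep.
have free_X t : closed_interval a b t -> free [seq X i t | i <- enum 'I_m.-1].
  by move=> /free_gX; rewrite free_cons => /andP[].
have [smooth_gamma _ _ _] := hgamma.
rewrite (rank_oneP hab smooth_gamma hX hV hsigma free_X) /=.
have sum0 (z : 'I_m.-1 -> 'rV[R]_(m + n)) :
    \sum_(j < m.-1) (0 : 'rV[R]_m.-1) 0 j *: z j = 0.
  by rewrite big1 // => j _; rewrite mxE scale0r.
(* At $u = 0$ the tangent space is spanned by $\dot\gamma$ and the $X_i$, a free family, so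
   [wedge_seq_span] translates membership into the equations. *)
split=> -[ruled_sigma XT]; split=> // j t It.
  apply/(wedge_seq_span _ (free_gX t It)).
  by have := XT j t It; rewrite sum0 addr0.
rewrite sum0 addr0; apply/(wedge_seq_span _ (free_gX t It)).
exact: XT.
Qed.
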